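(* Consider the $2$-user symmetric linear deterministic Z interference channel with unidirectional, rate-limited transmitter cooperation of capacity $C$ (a nonnegative integer) from transmitter $2$ to transmitter $1$, with integer parameters $m \ge 1$, $n \ge 0$, and suppose $0 \le \alpha \le 1$, where $\alpha = n/m$. Then the secrecy capacity region (under the perfect secrecy constraint) is the set of all $(R_1,R_2)$ with $R_1 \ge 0$, $R_2 \ge 0$ and $$R_1 \le m,\qquad R_2 \le m,\qquad R_1+R_2 \le 2m-n+C.$$
   Context: Model: let $q=\max\{m,n\}$ and let $\mathbf{D}$ be the $q\times q$ downshift matrix over $\mathbb{F}_2$ (entries $d_{j',j''}=1$ if $2\le j'=j''+1\le q$, and $0$ otherwise). At each channel use, transmitter $i$ sends $\mathbf{x}_i\in\mathbb{F}_2^q$, and the outputs are $\mathbf{y}_1=\mathbf{D}^{q-m}\mathbf{x}_1\oplus\mathbf{D}^{q-n}\mathbf{x}_2$ and $\mathbf{y}_2=\mathbf{D}^{q-m}\mathbf{x}_2$, where $\oplus$ is componentwise addition mod $2$. (Thus transmitter $1$ is not heard at receiver $2$: the channel is a Z-channel.) Transmitter $i$ has a message $W_i$ uniform on $\{1,\dots,2^{NR_i}\}$ ($N$ = block length, rates in bits per channel use). Transmitter $2$ can send to transmitter $1$, over a noiseless secure link, at most $C$ bits per channel use; transmitter $2$'s transmitted signal depends only on $W_2$ (and possibly its own randomness), while transmitter $1$'s signal at each time is a function of $W_1$, the bits received so far over the cooperative link (causality), and possibly locally generated random bits. Receiver $i$ decodes $W_i$ from $\mathbf{y}_i^N$. A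 rate pair is achievable with perfect secrecy if there are such codes with decoding error probability tending to $0$ as $N\to\infty$ and $I(W_i;\mathbf{y}_j^N)=0$ for $i\ne j$, $i,j\in\{1,2\}$. The secrecy capacity region is the closure of the set of achievable rate pairs. *)

(* Defs.v *)
From HB Require Import structures.
From mathcomp Require Import all_boot all_order all_algebra.
From mathcomp Require Import all_classical all_reals all_analysis.

Set Implicit Arguments.
Unset Strict Implicit.
Unset Printing Implicit Defensive.

Import Order.TTheory GRing.Theory Num.Theory numFieldNormedType.Exports.
Local Open Scope ring_scope.
Local Open Scope classical_set_scope.

Definition downshift (q : nat) : 'M['F_2]_q :=
  \matrix_(i < q, j < q) (((i : nat) == (j : nat).+1)%N)%:R.

Definition Dpow (q k : nat) : 'M['F_2]_q := iter k (mulmx (downshift q)) 1%:M.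

(** A block-length-N code for the Z-channel with unidirectional cooperation
    from Tx2 to Tx1 of C bits per channel use; message sets 'I_M1, 'I_M2;
    Tx i uses rb_i uniform private random bits. *)
Record zcode (m n C N M1 M2 : nat) := ZCode {
  rb1 : nat;
  rb2 : nat;
  enc2 : 'I_M2 -> {ffun 'I_rb2 -> bool} -> 'I_N -> 'cV['F_2]_(maxn m n);
  lnk : 'I_M2 -> {ffun 'I_rb2 -> bool} -> 'I_N -> {ffun 'I_C -> bool};
  enc1 : 'I_M1 -> {ffun 'I_rb1 -> bool} -> ('I_N -> {ffun 'I_C -> bool}) ->
         'I_N -> 'cV['F_2]_(maxn m n);
  enc1_causal : forall w r (l l' : 'I_N -> {ffun 'I_C -> bool}) (t : 'I_N),
      (forall s : 'I_N, (s < t)%N -> l s = l' s) -> enc1 w r l t = enc1 w r l' t;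
  dec1 : {ffun 'I_N -> 'cV['F_2]_(maxn m n)} -> 'I_M1;
  dec2 : {ffun 'I_N -> 'cV['F_2]_(maxn m n)} -> 'I_M2
}.

Arguments rb1 {m n C N M1 M2} _ : rename.
Arguments rb2 {m n C N M1 M2} _ : rename.
Arguments enc2 {m n C N M1 M2} _ _ _ _ : rename.
Arguments lnk {m n C N M1 M2} _ _ _ _ : rename.
Arguments enc1 {m n C N M1 M2} _ _ _ _ _ : rename.
Arguments dec1 {m n C N M1 M2} _ _ : rename.
Arguments dec2 {m n C N M1 M2} _ _ : rename.

Definition omega m n C N M1 M2 (c : zcode m n C N M1 M2) : finType :=
  ('I_M1 * 'I_M2 * {ffun 'I_(rb1 c) -> bool} * {ffun 'I_(rb2 c) -> bool})%type.

Section Code.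
Variables (m n C N M1 M2 : nat) (c : zcode m n C N M1 M2).
Let q := maxn m n.

Definition W1 (o : omega c) : 'I_M1 := o.1.1.1.
Definition W2 (o : omega c) : 'I_M2 := o.1.1.2.

Definition x2 (o : omega c) (t : 'I_N) := enc2 c o.1.1.2 o.2 t.
Definition x1 (o : omega c) (t : 'I_N) :=
  enc1 c o.1.1.1 o.1.2 (lnk c o.1.1.2 o.2) t.

Definition y1 (o : omega c) : {ffun 'I_N -> 'cV['F_2]_q} :=
  [ffun t => Dpow q (q - m) *m x1 o t + Dpow q (q - n) *m x2 o t].
Definition y2 (o : omega c) : {ffun 'I_N -> 'cV['F_2]_q} :=
  [ffun t => Dpow q (q - m) *m x2 o t].
End Code.

Definition prob (R : realType) (T : finType) (E : pred T) : R :=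
  #|[set x | E x]|%:R / #|T|%:R.

Definition mutinf (R : realType) (T A B : finType) (X : T -> A) (Y : T -> B) : R :=
  \sum_(a : A) \sum_(b : B)
    let pxy := prob R (fun w => (X w == a) && (Y w == b)) in
    if pxy == 0 then 0
    else pxy * (ln (pxy / (prob R (fun w => X w == a) * prob R (fun w => Y w == b)))
                / ln 2).

Definition perr (R : realType) m n C N M1 M2 (c : zcode m n C N M1 M2) : R :=
  prob R (fun o : omega c => (dec1 c (y1 o) != W1 o) || (dec2 c (y2 o) != W2 o)).

Definition perfectly_secure (R : realType) m n C N M1 M2 (c : zcode m n C N M1 M2) :=
  mutinf R (@W1 _ _ _ _ _ _ c) (@y2 _ _ _ _ _ _ c) = 0 /\
  mutinf R (@W2 _ _ _ _ _ _ c) (@y1 _ _ _ _ _ _ c) = 0.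

Definition nmsg (R : realType) (N : nat) (r : R) : nat :=
  `|Num.ceil (2 `^ (N%:R * r))|%N.

Definition achievable (R : realType) (m n C : nat) : set (R * R) := fun p =>
  0 <= p.1 /\ 0 <= p.2 /\
  exists c : forall N : nat, zcode m n C N (nmsg N p.1) (nmsg N p.2),
    (fun N => perr R (c N)) @ \oo --> 0%R /\
    forall N, perfectly_secure R (c N).

Definition secrecy_capacity_region (R : realType) (m n C : nat) : set (R * R) :=
  closure (@achievable R m n C).
Arguments secrecy_capacity_region R m n C : clear implicits.

(* Main.v *)
Require Import Defs.
From HB Require Import structures.
From mathcomp Require Import all_boot all_order all_algebra.
From mathcomp Require Import all_classical all_reals all_analysis.
From mathcomp Require Import perm zify lra ring.
Import Order.TTheory GRing.Theory Num.Theory numFieldNormedType.Exports.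
Local Open Scope ring_scope.

(** Converse: it needs no secrecy. For fixed randomness, a correctly decoded
    message pair is determined by y1, the link bits and the m - n levels of x2
    that receiver 1 does not hear, so there are at most 2^(N(2m - n + C)) such
    pairs; counting also gives the two individual bounds.

    Achievability: tx 1 sends data on a set S1 of (time, level) positions and
    uniform noise elsewhere, tx 2 sends data on a set S2 and zero elsewhere.
    Interference falling on S1 is announced over the link one slot ahead and
    cancelled by tx 1; interference falling outside S1 is masked by the noise.
    Hence y1 is independent of W2, and decoding is error free. Only the
    min(C, n) first levels, after the first slot, can be cancelled, so S1 and
    S2 can be chosen with any sizes k1, k2 <= Nm such that
    k1 + k2 <= 2Nm - Nn + (N - 1) min(C, n); any rate pair scaled by 1 - d
    satisfies this for N large. *)

(** * Powers of the downshift matrix *)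

Lemma DpowE (q k : nat) (i j : 'I_q) :
  Dpow q k i j = ((i : nat) == (j + k)%N)%:R.
Proof.
elim: k i => [|k IHk] i /=; first by rewrite !mxE addn0.
rewrite mxE; under eq_bigr do rewrite !mxE IHk -natrM mulnb.
rewrite -natr_sum; congr _%:R.
have [ij|/eqP ij] := eqVneq (i : nat) (j + k.+1)%N.
  have lt : (j + k < q)%N by have := ltn_ord i; lia.
  rewrite (bigD1 (Ordinal lt)) //= ij addnS !eqxx big1 // => l.
  by rewrite -val_eqE /= => /negbTE ->; rewrite andbF.
by rewrite big1 // => l _; case: eqP => //= il; case: eqP => // lj; lia.
Qed.

Definition row_up (q k : nat) (i : 'I_q) : 'I_q :=
  Ordinal (leq_ltn_trans (leq_subr k i) (ltn_ord i)).

Lemma mulDpowE (q k : nat) (v : 'cV['F_2]_q) (i : 'I_q) (j : 'I_1) :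
  (Dpow q k *m v) i j = if (k <= i)%N then v (row_up q k i) j else 0.
Proof.
rewrite mxE; under eq_bigr do rewrite DpowE.
case: ifPn => ki; last first.
  rewrite big1 // => l _; case: eqP => [il|_]; last by rewrite mul0r.
  by move: ki; rewrite il; lia.
rewrite (bigD1 (row_up q k i)) //= subnK // eqxx mul1r big1 ?addr0 // => l.
rewrite -val_eqE /= => /eqP li; case: eqP => [il|_]; last by rewrite mul0r.
by case: li; lia.
Qed.

Lemma mulDpow0 (q : nat) (v : 'cV['F_2]_q) : Dpow q 0 *m v = v.
Proof. exact: mul1mx. Qed.

(** * Counting, probability and mutual information *)

Lemma card_partition (T Z : finType) (P : pred T) (f : T -> Z) :
  #|P| = (\sum_z #|[pred o | P o && (f o == z)]|)%N.
Proof.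
rewrite -sum1_card (partition_big f xpredT) //=.
by apply: eq_bigr => z _; rewrite -sum1_card.
Qed.

Section Prob.
Variables (R : realType) (T : finType).

Lemma probE (E : pred T) : prob R E = #|E|%:R / #|T|%:R.
Proof.
rewrite /prob; congr (_%:R / _); apply: eq_card => x.
by rewrite [LHS]asboolb.
Qed.

Lemma prob_compl (E : pred T) : (0 < #|T|)%N ->
  prob R E = 1 - #|[pred x | ~~ E x]|%:R / #|T|%:R.
Proof.
move=> T0; rewrite probE -(cardC E) natrD.
have -> : #|[pred x | ~~ E x]| = #|[predC E]| by apply: eq_card.
have : (#|E|%:R + #|[predC E]|%:R : R) != 0.
  by rewrite -natrD cardC pnatr_eq0; lia.
by move=> ?; field.
Qed.

End Prob.

(** The injections carry each event [X = a, Y = b] into [X = a', Y = b], so by symmetry these events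
    have equal size. Thus [X] is uniform and independent of [Y], and every logarithm that occurs is
    that of 1. *)
Lemma mutinf_eq0 (R : realType) (T A B : finType) (X : T -> A) (Y : T -> B) :
  (forall a a' : A, exists2 g : T -> T, injective g &
     forall o, X o = a -> X (g o) = a' /\ Y (g o) = Y o) ->
  mutinf R X Y = 0.
Proof.
move=> Hg; rewrite /mutinf big1 // => a _; rewrite big1 // => b _ /=.
rewrite !probE; case: ifPn => // pab.
pose F a b := [pred o | (X o == a) && (Y o == b)].
have le_F a1 a2 b1 : (#|F a1 b1| <= #|F a2 b1|)%N.
  have [g g_inj gP] := Hg a1 a2.
  rewrite -(card_imset _ g_inj) subset_leq_card //.
  apply/fintype.subsetP => z /imsetP[u + {z}->].
  rewrite !inE => /andP[/eqP Xo /eqP Yo].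
  by have [-> ->] := gP _ Xo; rewrite Yo !eqxx.
have eq_F a1 a2 b1 : #|F a1 b1| = #|F a2 b1| by apply/eqP; rewrite eqn_leq !le_F.
have cardY b1 : #|[pred o | Y o == b1]| = (#|A| * #|F a b1|)%N.
  rewrite (card_partition _ _ _ X) -sum_nat_const; apply: eq_bigr => a' _.
  by rewrite (eq_F a a'); apply: eq_card => o; rewrite !inE andbC.
have cardX a1 : #|[pred o | X o == a1]| = (\sum_b1 #|F a b1|)%N.
  by rewrite (card_partition _ _ _ Y); apply: eq_bigr => b1 _; rewrite (eq_F a a1).
have cardT : #|T| = (#|A| * #|[pred o | X o == a]|)%N.
  rewrite (card_partition _ _ xpredT X) -sum_nat_const; apply: eq_bigr => a' _.
  by rewrite cardX -(cardX a').
have F0 : #|F a b| != 0%N.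
  by apply: contraNneq pab; rewrite /F => ->; rewrite mul0r.
have X0 : #|[pred o | X o == a]| != 0%N.
  rewrite cardX (bigD1 b) //=; lia.
have A0 : #|A| != 0%N by rewrite -lt0n; apply/card_gt0P; exists a.
rewrite (_ : _ / (_ * _) = 1) ?ln1 ?mul0r ?mulr0 //.
rewrite (_ : #|fun w => Y w == b| = (#|A| * #|F a b|)%N); last exact: cardY.
rewrite (_ : #|fun w => X w == a| = #|[pred o | X o == a]|) //.
rewrite (_ : #|fun w => (X w == a) && _| = #|F a b|) //.
rewrite cardT !natrM.
by field; rewrite !pnatr_eq0 A0 X0 F0.
Qed.

(** * The cancelling and masking scheme *)

Lemma natr_addb (a b : bool) : (a (+) b)%:R = a%:R + b%:R :> 'F_2.
Proof. by case: a; case: b; apply/val_inj. Qed.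

Lemma natr_F2_eq1 (b : bool) : ((b%:R : 'F_2) == 1) = b.
Proof. by case: b. Qed.

Section Scheme.
Variables (m n C N M1 M2 : nat).
Hypothesis nm : (n <= m)%N.
Let q := maxn m n.
Let pos : finType := ('I_N * 'I_q)%type.

Variables (S1 S2 : {set pos}) (e1 : 'I_M1 -> {set pos}) (e2 : 'I_M2 -> {set pos}).
Hypothesis e1_S1 : forall w, e1 w \subset S1.
Hypothesis e2_S2 : forall w, e2 w \subset S2.

(** The position of [x2] that lands on [p] at receiver 1. Subtraction truncates, so this is
    meaningful only for [q - n <= p.2]. *)
Definition interferer (p : pos) : pos := (p.1, row_up q (q - n) p.2).

Hypothesis cancellable : forall p : pos,
  p \in S1 -> (q - n <= p.2)%N -> interferer p \in S2 ->
  (0 < p.1)%N && (p.2 - (q - n) < C)%N.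

Definition interference (w : 'I_M2) (p : pos) : bool :=
  (q - n <= p.2)%N && (interferer p \in e2 w).

(** The look-ahead by one slot is possible because the signal of transmitter 2 is fixed by its
    message alone. *)
Definition scheme_lnk (w : 'I_M2) (t : 'I_N) : {ffun 'I_C -> bool} :=
  [ffun j : 'I_C => [exists p : pos,
     [&& p \in e2 w, p.1 == t.+1 :> nat & p.2 == j :> nat]]].

(* Reads only link slots strictly before [p.1], as causality requires. *)
Definition predicted (l : 'I_N -> {ffun 'I_C -> bool}) (p : pos) : bool :=
  (q - n <= p.2)%N &&
  [exists s : 'I_N, exists j : 'I_C,
     [&& p.1 == s.+1 :> nat, p.2 - (q - n) == j :> nat & l s j]]%N.

Definition scheme_enc1 (w : 'I_M1) (r : {ffun 'I_#|pos| -> bool})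
    (l : 'I_N -> {ffun 'I_C -> bool}) (t : 'I_N) : 'cV['F_2]_q :=
  \col_i (((t, i) \in e1 w)%:R +
    (if (t, i) \in S1 then predicted l (t, i) else r (enum_rank ((t, i) : pos)))%:R).

Definition scheme_enc2 (w : 'I_M2) (t : 'I_N) : 'cV['F_2]_q :=
  \col_i ((t, i) \in e2 w)%:R.

Lemma scheme_enc1_causal w r (l l' : 'I_N -> {ffun 'I_C -> bool}) (t : 'I_N) :
  (forall s : 'I_N, (s < t)%N -> l s = l' s) ->
  scheme_enc1 w r l t = scheme_enc1 w r l' t.
Proof.
move=> ll'; apply/colP => i; rewrite !mxE /predicted /=.
congr (_ + (if _ then _ && _ else _)%:R).
apply: eq_existsb => s; apply: eq_existsb => j.
by case: eqP => //= t_s; rewrite ll' // t_s.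
Qed.

Definition scheme_dec (M : nat) (w0 : 'I_M) (S : {set pos}) (e : 'I_M -> {set pos})
    (y : {ffun 'I_N -> 'cV['F_2]_q}) : 'I_M :=
  odflt w0 [pick w | e w == [set p in S | y p.1 p.2 0 == 1]%SET].

Lemma scheme_decK M (w0 : 'I_M) (S : {set pos}) (e : 'I_M -> {set pos})
    (y : {ffun 'I_N -> 'cV['F_2]_q}) w :
  injective e -> e w \subset S ->
  (forall p, p \in S -> y p.1 p.2 0 = (p \in e w)%:R) ->
  scheme_dec M w0 S e y = w.
Proof.
move=> e_inj ewS yE; rewrite /scheme_dec.
have -> : [set p in S | y p.1 p.2 0 == 1]%SET = e w.
  apply/setP => p; rewrite !inE; case pS: (p \in S).
    by rewrite yE // natr_F2_eq1.
  by apply/esym/negbTE; apply: contraFN pS; exact: (fintype.subsetP ewS).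
by case: pickP => [w' /eqP /e_inj|/(_ w)] //; rewrite eqxx.
Qed.

Variables (w01 : 'I_M1) (w02 : 'I_M2).

Definition scheme : zcode m n C N M1 M2 :=
  @ZCode m n C N M1 M2 #|pos| 0 (fun w _ => scheme_enc2 w) (fun w _ => scheme_lnk w)
    scheme_enc1 scheme_enc1_causal
    (scheme_dec M1 w01 S1 e1) (scheme_dec M2 w02 S2 e2).

(** By [cancellable], every interfering one on [S1] was announced one slot earlier; conversely, an
    announced bit fixes a time and a row, hence the interferer. *)
Lemma predicted_interference w p :
  p \in S1 -> predicted (scheme_lnk w) p = interference w p.
Proof.
move=> pS1; rewrite /predicted /interference; case: leqP => //= n_p.
apply/existsP/idP => [[s /existsP[j /and3P[/eqP ps /eqP pj]]]|p_e2].
  rewrite ffunE => /existsP[p' /and3P[p'_e2 /eqP p's /eqP p'j]].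
  suff -> : interferer p = p' by [].
  case: p' {p'_e2} p's p'j => t' i' /= t's i'j.
  by congr (_, _); apply: val_inj; rewrite /= ?ps ?pj.
have /andP[p_gt0 p_C] := cancellable p pS1 n_p (fintype.subsetP (e2_S2 w) _ p_e2).
have s_N : (p.1.-1 < N)%N by have := ltn_ord p.1; lia.
exists (Ordinal s_N); apply/existsP; exists (Ordinal p_C).
rewrite /= prednK // !eqxx ffunE /=; apply/existsP; exists (interferer p).
by rewrite p_e2 /= prednK // !eqxx.
Qed.

Lemma y2_scheme (o : omega scheme) (p : pos) :
  y2 o p.1 p.2 0 = (p \in e2 (W2 o))%:R.
Proof.
rewrite ffunE; have -> : (maxn m n - m = 0)%N by lia.
by rewrite mulDpow0 mxE -surjective_pairing.
Qed.

Lemma y1_scheme (o : omega scheme) (p : pos) :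
  y1 o p.1 p.2 0 = (p \in e1 (W1 o))%:R +
    (if p \in S1 then 0
     else (o.1.2 (enum_rank p) (+) interference (W2 o) p)%:R).
Proof.
rewrite ffunE; have -> : (maxn m n - m = 0)%N by lia.
rewrite mulDpow0 mxE mulDpowE [x1 _ _ _ _]mxE -surjective_pairing.
have -> : (if (maxn m n - n <= p.2)%N
           then x2 o p.1 (row_up (maxn m n) (maxn m n - n) p.2) 0 else 0) =
          (interference (W2 o) p)%:R.
  by rewrite /interference; case: ifP => // _; rewrite mxE.
rewrite -addrA; congr (_ + _); case: ifP => [pS1|_]; last by rewrite natr_addb.
by rewrite predicted_interference // -natr_addb addbb.
Qed.

(** [y2] ignores [W1]. For [W2], exchanging [a] and [a'] while flipping the noise outside [S1] where
    the two interferences differ is an injection that preserves [y1] whenever [W2] is [a]. *)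
Lemma scheme_secure (R : realType) : perfectly_secure R scheme.
Proof.
split; apply: mutinf_eq0 => a a'.
  exists (fun o => (tperm a a' o.1.1.1, o.1.1.2, o.1.2, o.2)).
    move=> [[[w1 w2] r1] r2] [[[w1' w2'] r1'] r2'] /= [].
    by move=> /perm_inj -> -> -> ->.
  by move=> o /= <-; rewrite /W1 /= tpermL; split.
pose d p := (p \notin S1) && (interference a p (+) interference a' p).
pose rerandomize (r : {ffun 'I_#|pos| -> bool}) : {ffun 'I_#|pos| -> bool} :=
  [ffun k => r k (+) d (enum_val k)].
pose g (o : omega scheme) : omega scheme :=
  (o.1.1.1, tperm a a' o.1.1.2, rerandomize o.1.2, o.2).
exists g.
  move=> [[[w1 w2] r1] r2] [[[w1' w2'] r1'] r2'] /= [].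
  move=> -> /perm_inj -> /ffunP rr' ->; congr (_, _, _, _).
  by apply/ffunP => k; have := rr' k; rewrite !ffunE => /addIb.
move=> o o_a; have W2g : W2 (g o) = a' by rewrite /W2 /= -/(W2 o) o_a tpermL.
split=> //; apply/ffunP => t; apply/colP => i.
rewrite (y1_scheme _ (t, i)) [RHS](y1_scheme _ (t, i)) W2g o_a.
congr (_ + _); case: ifP => // iS1; rewrite ffunE enum_rankK /d iS1 /=.
by congr (_%:R); rewrite -addbA addbK.
Qed.

Lemma scheme_perr (R : realType) : injective e1 -> injective e2 ->
  perr R scheme = 0.
Proof.
move=> e1_inj e2_inj; rewrite /perr probE eq_card0 ?mul0r // => o.
rewrite !inE /=; apply/negbTE; rewrite negb_or !negbK.
apply/andP; split; apply/eqP; apply: scheme_decK => // p pS.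
  by rewrite y1_scheme pS addr0.
exact: y2_scheme.
Qed.

End Scheme.

(** * Choice of the data positions *)

Lemma ex_injective_powerset (T : finType) (S : {set T}) (M : nat) :
  (M <= 2 ^ #|S|)%N ->
  exists2 e : 'I_M -> {set T}, injective e & forall w, e w \subset S.
Proof.
rewrite -card_powerset => leM.
exists (fun w => enum_val (widen_ord leM w)).
  by move=> w w' /enum_val_inj /(congr1 val) /= ww'; apply: val_inj.
by move=> w; rewrite -powersetE enum_valP.
Qed.

Lemma ex_subset_card (T : finType) (U : {set T}) (k : nat) :
  (k <= #|U|)%N -> exists2 V : {set T}, V \subset U & #|V| = k.
Proof.
move=> k_U; exists [set x in take k (enum U)]%SET.
  apply/fintype.subsetP => x; rewrite inE => /mem_take.
  by rewrite mem_enum.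
rewrite cardsE (card_uniqP _) ?take_uniq ?enum_uniq // size_take -cardE.
by case: ltngtP k_U.
Qed.

Lemma card_ord_lt (q k : nat) : (k <= q)%N ->
  #|[set j : 'I_q | (j < k)%N]%SET| = k.
Proof.
move=> k_q; rewrite -sum1_card (eq_bigl (fun j : 'I_q => (j < k)%N)).
  by rewrite -(big_ord_widen q (fun=> 1%N)) // sum_nat_const card_ord muln1.
by move=> j; rewrite !inE.
Qed.

(** [I] holds the positions of transmitter 2 heard at receiver 1, [A] those that the link can
    cancel, [U] the harmful rest. [S2] takes everything outside [U] and from [U] only the forced
    excess [U2]; [S1] gives up exactly the positions hit by [U2]. *)
Lemma ex_positions (m n C N k1 k2 : nat) : (n <= m)%N ->
  (k1 <= N * m)%N -> (k2 <= N * m)%N ->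
  (k1 + k2 + N * n <= 2 * (N * m) + N.-1 * minn C n)%N ->
  exists S1 S2 : {set 'I_N * 'I_(maxn m n)},
  [/\ (k1 <= #|S1|)%N, (k2 <= #|S2|)%N &
   forall p, p \in S1 -> (maxn m n - n <= p.2)%N -> interferer m n N p \in S2 ->
     (0 < p.1)%N && (p.2 - (maxn m n - n) < C)%N].
Proof.
move=> nm k1_le k2_le k12_le.
have q_m : maxn m n = m by apply/maxn_idPl.
pose A : {set 'I_N * 'I_(maxn m n)} :=
  finset.setX [set t : 'I_N | (0 < t)%N]%SET
    [set j : 'I_(maxn m n) | (j < minn C n)%N]%SET.
pose I : {set 'I_N * 'I_(maxn m n)} :=
  finset.setX [set: 'I_N]%SET [set j : 'I_(maxn m n) | (j < n)%N]%SET.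
pose U : {set 'I_N * 'I_(maxn m n)} := (I :\: A)%SET.
have cardT : #|{: 'I_N * 'I_(maxn m n)}| = (N * m)%N.
  by rewrite card_prod !card_ord q_m.
have cardA : #|A| = (N.-1 * minn C n)%N.
  rewrite cardsX card_ord_lt; last by lia.
  congr (_ * _)%N; case: (posnP N) => [N0|N_gt0].
    rewrite [in RHS]N0; apply: eq_card0 => t.
    by have := ltn_ord t; rewrite [X in (_ < X)%N]N0.
  have -> : [set t : 'I_N | (0 < t)%N]%SET = (~: [set t : 'I_N | (t < 1)%N])%SET.
    by apply/setP => t; rewrite !inE; lia.
  by rewrite cardsCs finset.setCK card_ord_lt // card_ord subn1.
have cardI : #|I| = (N * n)%N.
  by rewrite cardsX cardsT card_ord card_ord_lt //; lia.
have cardU : (#|U| + N.-1 * minn C n = N * n)%N.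
  rewrite -cardA -cardI -(cardsID A I) [RHS]addnC; congr (_ + _)%N.
  apply: eq_card => p; rewrite !inE leq_min.
  by case: (p.2 < n)%N; rewrite ?andbF /= ?andbF.
move: {cardA} (N.-1 * minn C n)%N k12_le cardU => s k12_le cardU.
have U_T : (#|U| <= N * m)%N by rewrite -cardT max_card.
(* Truncated subtraction makes [U2] empty when [k2] positions fit outside [U]. *)
have [U2 U2U cardU2] := ex_subset_card _ U (k2 - (N * m - #|U|)) ltac:(lia).
pose blocked := [set p : 'I_N * 'I_(maxn m n) |
  (maxn m n - n <= p.2)%N && (interferer m n N p \in U2)]%SET.
have blocked_U2 : (#|blocked| <= #|U2|)%N.
  have interferer_inj : {in blocked &, injective (interferer m n N)}.
    move=> [t i] [t' i']; rewrite !inE /= => /andP[n_i _] /andP[n_i' _] [-> ii'].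
    by congr (_, _); apply: val_inj; rewrite /= -(subnK n_i) ii' subnK.
  rewrite -(card_in_imset interferer_inj) subset_leq_card //.
  apply/fintype.subsetP => _ /imsetP[p + ->].
  by rewrite inE => /andP[].
exists (~: blocked)%SET, (~: U :|: U2)%SET; split.
- have := cardsC blocked; rewrite cardT; move: blocked_U2; clearbody blocked.
  move: (#|blocked|) (#|~: blocked|) => b b'; move: cardU2 U_T cardU.
  by move: (#|U2|) (#|U|) => u2 u; lia.
- have /eqP -> : (#|~: U :|: U2| == #|~: U| + #|U2|)%N.
    by rewrite leq_card_setU disjoint_sym finset.disjoints_subset finset.setCK.
  have := cardsC U; rewrite cardT; move: cardU2 U_T; clearbody U.
  by move: (#|U2|) (#|U|) (#|~: U|) => u2 u u'; lia.
(* As [p] is not blocked, its interferer is not in [U2], hence lies outside [U]. Its row index is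
   below [n], which forces it into [A]. *)
move=> p; rewrite !inE negb_and => /orP[/negbTE -> //|/negbTE ->] n_p.
rewrite orbF negb_and negbK leq_min /=.
have row_lt (i : 'I_(maxn m n)) :
    (maxn m n - n <= i)%N -> (i - (maxn m n - n) < n)%N.
  by have := ltn_ord i; lia.
by case/orP => [/and3P[-> ->]|] //; rewrite row_lt.
Qed.

Local Open Scope classical_set_scope.

(** * Converse at a fixed block length *)

Section Converse.
Variables (m n C N M1 M2 : nat) (c : zcode m n C N M1 M2).
Hypothesis nm : (n <= m)%N.
Let q := maxn m n.
Let q_m : q = m. Proof. exact/maxn_idPl. Qed.

Definition decoded : pred (omega c) := fun o =>
  (dec1 c (y1 o) == W1 o) && (dec2 c (y2 o) == W2 o).

Lemma card_omega : #|omega c| = (M1 * M2 * (2 ^ rb1 c * 2 ^ rb2 c))%N.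
Proof. by rewrite /omega !card_prod !card_ffun !card_ord card_bool mulnA. Qed.

Lemma card_outputs : #|{ffun 'I_N -> 'cV['F_2]_q}| = (2 ^ (N * m))%N.
Proof.
rewrite card_ffun card_mx !card_ord muln1 -expnM mulnC.
by rewrite q_m.
Qed.

Let rnd := ({ffun 'I_(rb1 c) -> bool} * {ffun 'I_(rb2 c) -> bool})%type.

Let card_rnd : #|{: rnd}| = (2 ^ rb1 c * 2 ^ rb2 c)%N.
Proof. by rewrite card_prod !card_ffun !card_ord card_bool. Qed.

Lemma card_decoded_rate1 :
  (#|decoded| <= M2 * 2 ^ (N * m) * (2 ^ rb1 c * 2 ^ rb2 c))%N.
Proof.
have -> : (M2 * 2 ^ (N * m) * (2 ^ rb1 c * 2 ^ rb2 c))%N =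
    #|{: 'I_M2 * {ffun 'I_N -> 'cV['F_2]_q} * rnd}|.
  by rewrite card_prod card_prod card_outputs card_rnd card_ord.
apply: (@leq_card_in _ _ (fun o => (W2 o, y1 o, (o.1.2, o.2)))).
move=> [[[w1 w2] r1] r2] [[[w1' w2'] r1'] r2'].
move=> /andP[/eqP o1 _] /andP[/eqP o1' _].
case=> w22 y11 r11 r22; move: o1; rewrite y11 o1' /W1 /= => ->.
by move: w22; rewrite /W2 /= r11 r22 => ->.
Qed.

Lemma card_decoded_rate2 :
  (#|decoded| <= M1 * 2 ^ (N * m) * (2 ^ rb1 c * 2 ^ rb2 c))%N.
Proof.
have -> : (M1 * 2 ^ (N * m) * (2 ^ rb1 c * 2 ^ rb2 c))%N =
    #|{: 'I_M1 * {ffun 'I_N -> 'cV['F_2]_q} * rnd}|.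
  by rewrite card_prod card_prod card_outputs card_rnd card_ord.
apply: (@leq_card_in _ _ (fun o => (W1 o, y2 o, (o.1.2, o.2)))).
move=> [[[w1 w2] r1] r2] [[[w1' w2'] r1'] r2'].
move=> /andP[_ /eqP o2] /andP[_ /eqP o2'].
case=> w11 y22 r11 r22; move: o2; rewrite y22 o2' /W2 /= => ->.
by move: w11; rewrite /W1 /= r11 r22 => ->.
Qed.

(* Knowing the randomness, [y1], the link and the [m - n] rows of [x2] unheard
   at receiver 1 one recovers, in this order, W1, x1, the interference, x2
   and W2. *)
Lemma card_decoded_sum_rate :
  (#|decoded| <= 2 ^ (N * (m + C + (m - n))) * (2 ^ rb1 c * 2 ^ rb2 c))%N.
Proof.
have low_lt (j : 'I_(m - n)) : (n + j < q)%N.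
  by rewrite q_m; have := ltn_ord j; lia.
pose low (o : omega c) : {ffun 'I_N -> {ffun 'I_(m - n) -> 'F_2}} :=
  [ffun t => [ffun j => x2 o t (Ordinal (low_lt j)) 0]].
pose link (o : omega c) : {ffun 'I_N -> {ffun 'I_C -> bool}} :=
  [ffun t => lnk c (W2 o) o.2 t].
have -> : (2 ^ (N * (m + C + (m - n))))%N =
    #|{: {ffun 'I_N -> 'cV['F_2]_q} * {ffun 'I_N -> {ffun 'I_C -> bool}} *
         {ffun 'I_N -> {ffun 'I_(m - n) -> 'F_2}}}|.
  rewrite !card_prod card_outputs !card_ffun !card_ord card_bool -!expnM -!expnD.
  by congr (_ ^ _)%N; lia.
rewrite -card_rnd -card_prod.
apply: (@leq_card_in _ _ (fun o => (y1 o, link o, low o, (o.1.2, o.2)))).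
move=> o o' /andP[/eqP d1 /eqP d2] /andP[/eqP d1' /eqP d2'].
move=> [y11 link_eq low_eq r1_eq r2_eq].
have w1_eq : W1 o = W1 o' by rewrite -d1 -d1' y11.
have x1_eq t : x1 o t = x1 o' t.
  rewrite /x1 r1_eq (_ : o.1.1.1 = o'.1.1.1) //.
  (* The links agree only pointwise; causality stands in for extensionality. *)
  by apply: enc1_causal => s _; move/ffunP/(_ s): link_eq; rewrite !ffunE.
have x2_eq t : x2 o t = x2 o' t.
  apply/colP => i; have [i_n|n_i] := ltnP i n.
    have lt : (i + (q - n) < q)%N.
      by have i_q : (i < q)%N := ltn_ord i; lia.
    move/ffunP/(_ t): y11; rewrite !ffunE x1_eq => /addrI.
    move/matrixP/(_ (Ordinal lt) 0); rewrite !mulDpowE /= leq_addl.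
    by rewrite (_ : row_up _ _ _ = i) //; apply: val_inj; rewrite /= addnK.
  have lt : (i - n < m - n)%N.
    by have i_q : (i < q)%N := ltn_ord i; lia.
  move/ffunP/(_ t): low_eq; rewrite !ffunE => /ffunP/(_ (Ordinal lt)).
  rewrite !ffunE (_ : Ordinal _ = i) //.
  by apply: val_inj; rewrite /= subnKC.
have y22 : y2 o = y2 o' by apply/ffunP => t; rewrite !ffunE x2_eq.
have : W2 o = W2 o' by rewrite -d2 -d2' y22.
move: w1_eq r1_eq r2_eq; rewrite /W1 /W2.
case: o {d1 d2 y11 link_eq low_eq x1_eq x2_eq y22} => [[[? ?] ?] ?].
by case: o' {d1' d2'} => [[[? ?] ?] ?] /= -> -> -> ->.
Qed.

(** [1 - perr] is the fraction of correctly decoded outcomes, and [omega] is the product of the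
    message pairs with the randomness, whose size cancels. *)
Lemma perr_lower_bound (R : realType) (K : nat) : (0 < M1)%N -> (0 < M2)%N ->
  (#|decoded| <= K * (2 ^ rb1 c * 2 ^ rb2 c))%N ->
  (1 - perr R c) * (M1 * M2)%:R <= K%:R :> R.
Proof.
move=> M1_gt0 M2_gt0 leK.
have rnd_gt0 : (0 < 2 ^ rb1 c * 2 ^ rb2 c)%N by rewrite muln_gt0 !expn_gt0.
rewrite /perr prob_compl ?card_omega ?muln_gt0 ?M1_gt0 ?M2_gt0 ?expn_gt0 //.
rewrite (_ : #|_| = #|decoded|); last first.
  by apply: eq_card => o; rewrite !inE negb_or !negbK.
rewrite opprB addrC subrK natrM invfM mulrA mulrAC.
rewrite mulfVK; last by rewrite pnatr_eq0 -lt0n muln_gt0 M1_gt0.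
rewrite ler_pdivrMr ?ltr0n //.
by rewrite -natrM ler_nat.
Qed.

End Converse.

(** * From message counts to rates *)

Lemma nmsg_ge (R : realType) (N : nat) (r : R) : 2 `^ (N%:R * r) <= (nmsg N r)%:R.
Proof.
rewrite /nmsg [leRHS]pmulrn gez0_abs ?ceil_ge //.
by rewrite ceil_ge0 (lt_le_trans _ (powR_ge0 _ _)) // ltrN10.
Qed.

Lemma nmsg_gt0 (R : realType) (N : nat) (r : R) : (0 < nmsg N r)%N.
Proof.
by rewrite -(ltr0n R) (lt_le_trans _ (nmsg_ge _ _ _)) // powR_gt0.
Qed.

(** Logarithms give [N * (r - k) <= 1] for all large [N], which fails beyond [1 / (r - k)] if
    [k < r]. The factor 2 leaves room for an error probability of one half. *)
Lemma rate_le (R : realType) (r k : R) :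
  (\forall N \near \oo, 2 `^ (N%:R * r) <= 2 * 2 `^ (N%:R * k)) -> r <= k.
Proof.
move=> [N0 _ le_N]; rewrite leNgt; apply/negP => k_r.
pose N := (maxn N0 `|Num.ceil (r - k)^-1|.+1)%N.
have := le_N N (leq_maxl _ _).
rewrite -{2}[2]powRr1 // -powRD ?pnatr_eq0 ?implybT //.
rewrite -ler_ln ?posrE ?powR_gt0 // !ln_powR ler_pM2r ?ln_gt0 ?ltr1n //.
apply/negP; rewrite -ltNge -ltrBrDr -mulrBr -ltr_pdivrMr ?subr_gt0 // mul1r.
apply: le_lt_trans (ceil_ge _) _.
rewrite [ltRHS]pmulrn ltr_int.
by apply: (le_lt_trans (ler_norm _)); rewrite -abszE ltz_nat leq_maxr.
Qed.

Lemma achievable_bounds (R : realType) (m n C : nat) (p : R * R) :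
  (n <= m)%N -> @achievable R m n C p ->
  0 <= p.1 /\ 0 <= p.2 /\ p.1 <= m%:R /\ p.2 <= m%:R /\
  p.1 + p.2 <= 2 * m%:R - n%:R + C%:R.
Proof.
move=> nm [p1_ge0 [p2_ge0 [c [c_err _]]]].
have M_gt0 := @nmsg_gt0 R.
have pow2 (N k : nat) : (2 ^ (N * k))%:R = 2 `^ (N%:R * k%:R) :> R.
  by rewrite -natrM powR_mulrn // natrX.
have err_near : \forall N \near \oo, 2^-1 <= 1 - perr R (c N).
  have half : (0 : R) < 2^-1 by rewrite invr_gt0.
  near=> N.
  have : `|perr R (c N)| < 2^-1 by near: N; exact: cvgr0_norm_lt.
  by move/ltr_normlW; lra.
(* [K] counts the values of the message given as side information: the size of the other message set
   for an individual rate, 1 for the sum rate. It cancels from both sides. *)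
have key (r : R) (k : nat) : (forall N, exists K : nat,
   2 `^ (N%:R * r) * K%:R <= (nmsg N p.1 * nmsg N p.2)%:R /\ (0 < K)%N /\
   (#|decoded m n C N _ _ (c N)| <=
     K * 2 ^ (N * k) * (2 ^ rb1 (c N) * 2 ^ rb2 (c N)))%N) -> r <= k%:R.
  move=> H; apply: rate_le; near=> N.
  have [K [K_le [K_gt0]]] := H N.
  move/(perr_lower_bound _ _ _ _ _ _ _ R _ (M_gt0 _ _) (M_gt0 _ _)) => le_K.
  have e_N : 2^-1 <= 1 - perr R (c N) by near: N.
  have : 2^-1 * (2 `^ (N%:R * r) * K%:R) <= (K * 2 ^ (N * k))%:R.
    apply: (le_trans _ le_K); apply: ler_pM => //.
  rewrite natrM pow2 mulrA [leRHS]mulrC ler_pM2r ?ltr0n // [leLHS]mulrC.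
  by rewrite ler_pdivrMr // [leRHS]mulrC.
split=> //; split=> //; split; last split.
- apply: key => N; exists (nmsg N p.2); split; last first.
    by split; [exact: M_gt0|exact: card_decoded_rate1].
  by rewrite natrM ler_wpM2r ?nmsg_ge.
- apply: key => N; exists (nmsg N p.1); split; last first.
    by split; [exact: M_gt0|exact: card_decoded_rate2].
  by rewrite natrM mulrC ler_wpM2l ?nmsg_ge.
have -> : 2 * m%:R - n%:R + C%:R = (m + C + (m - n))%:R :> R.
  by rewrite !natrD natrB //; ring.
apply: key => N; exists 1%N; split; last first.
  by rewrite mul1n; split=> //; exact: card_decoded_sum_rate.
rewrite mulr1 mulrDr powRD ?pnatr_eq0 ?implybT // natrM.
by rewrite ler_pM ?powR_ge0 ?nmsg_ge.
Unshelve. all: by end_near. Qed.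

(** * Achievability of scaled rate pairs *)

Lemma ex_secure_code (R : realType) (m n C N M1 M2 k1 k2 : nat) :
  (n <= m)%N -> (0 < M1)%N -> (0 < M2)%N ->
  exists c : zcode m n C N M1 M2, perfectly_secure R c /\
    ((M1 <= 2 ^ k1)%N -> (M2 <= 2 ^ k2)%N -> (k1 <= N * m)%N -> (k2 <= N * m)%N ->
     (k1 + k2 + N * n <= 2 * (N * m) + N.-1 * minn C n)%N -> perr R c = 0).
Proof.
move=> nm M1_gt0 M2_gt0; pose w1 := Ordinal M1_gt0; pose w2 := Ordinal M2_gt0.
have [[M1_le [M2_le [k1_le [k2_le k12_le]]]]|short] := pselect
   ((M1 <= 2 ^ k1)%N /\ (M2 <= 2 ^ k2)%N /\ (k1 <= N * m)%N /\ (k2 <= N * m)%N /\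
    (k1 + k2 + N * n <= 2 * (N * m) + N.-1 * minn C n)%N); last first.
  (* Achievability asks for a secure code at every block length. When the counting conditions fail,
     empty position sets do: [y2] is zero and [y1] is pure noise. *)
  have sub0 M (w : 'I_M) :
    (finset.set0 : {set 'I_N * 'I_(maxn m n)}) \subset finset.set0.
    exact: finset.sub0set.
  have canc0 p : p \in (finset.set0 : {set 'I_N * 'I_(maxn m n)}) ->
      (maxn m n - n <= p.2)%N -> interferer m n N p \in finset.set0 ->
      (0 < p.1)%N && (p.2 - (maxn m n - n) < C)%N by rewrite inE.
  exists (scheme m n C N M1 M2 finset.set0 finset.set0
    (fun=> finset.set0) (fun=> finset.set0) w1 w2).
  split; first exact: (scheme_secure _ _ _ _ _ _ nm _ _ _ _ (sub0 M2) canc0).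
  by move=> *; case: short.
have [S1 [S2 [k1_S1 k2_S2 canc]]] := ex_positions _ _ C _ _ _ nm k1_le k2_le k12_le.
have [e1 e1_inj e1_S1] := ex_injective_powerset _ S1 _
  (leq_trans M1_le (leq_pexp2l (ltn0Sn 1) k1_S1)).
have [e2 e2_inj e2_S2] := ex_injective_powerset _ S2 _
  (leq_trans M2_le (leq_pexp2l (ltn0Sn 1) k2_S2)).
exists (scheme m n C N M1 M2 S1 S2 e1 e2 w1 w2); split.
  exact: scheme_secure.
by move=> *; exact: scheme_perr.
Qed.

(** Take [k] the ceiling of [N * r]: the integer [2 ^ k] also bounds the ceiling of the real
    power. *)
Lemma nmsg_le (R : realType) (N : nat) (r : R) : 0 <= r ->
  exists2 k : nat, (nmsg N r <= 2 ^ k)%N & k%:R < N%:R * r + 1.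
Proof.
move=> r_ge0; have Nr_ge0 : 0 <= N%:R * r by rewrite mulr_ge0.
have := ceil_itv (N%:R * r).
have : 0 <= Num.ceil (N%:R * r) by rewrite ceil_ge0 (lt_le_trans _ Nr_ge0) ?ltrN10.
case: (Num.ceil _) => // k _; rewrite intrD => /andP[k_gt k_ge].
exists k; last by rewrite -ltrBlDr.
rewrite -lez_nat /nmsg gez0_abs; last first.
  by rewrite ceil_ge0 (lt_le_trans _ (powR_ge0 _ _)) ?ltrN10.
by rewrite ceil_le_int -pmulrn natrX -powR_mulrn // ler_powR // ler1n.
Qed.

(** Scaling by [1 - d] gains at least [N * d] in the sum constraint, which for large [N] exceeds the
    bounded losses, so the error is eventually exactly zero. *)
Lemma scaled_achievable (R : realType) (m n C : nat) (p : R * R) (d : R) :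
  (1 <= m)%N -> (n <= m)%N -> 0 < d < 1 ->
  0 <= p.1 -> 0 <= p.2 -> p.1 <= m%:R -> p.2 <= m%:R ->
  p.1 + p.2 <= 2 * m%:R - n%:R + C%:R ->
  @achievable R m n C ((1 - d) * p.1, (1 - d) * p.2).
Proof.
move=> m_gt0 nm /andP[d_gt0 d_lt1] p1_ge0 p2_ge0 p1_le p2_le p12_le.
have d1 : 0 <= 1 - d by lra.
have r1_ge0 : 0 <= (1 - d) * p.1 by rewrite mulr_ge0.
have r2_ge0 : 0 <= (1 - d) * p.2 by rewrite mulr_ge0.
split=> //; split=> //=.
have H (N : nat) : exists c : zcode m n C N (nmsg N ((1 - d) * p.1))
                                        (nmsg N ((1 - d) * p.2)),
    (* The loss [n + 2] collects at most [n] for the first slot, where nothing can be cancelled, and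
       1 for rounding up each of the two exponents. *)
    perfectly_secure R c /\ (n%:R + 2 <= N%:R * d -> perr R c = 0).
  have [k1 M1_le k1_lt] := nmsg_le _ N _ r1_ge0.
  have [k2 M2_le k2_lt] := nmsg_le _ N _ r2_ge0.
  have [c [c_sec c_err]] := ex_secure_code R m n C N _ _ k1 k2 nm
     (nmsg_gt0 _ N ((1 - d) * p.1)) (nmsg_gt0 _ N ((1 - d) * p.2)).
  exists c; split=> // N_large; apply: c_err => //.
  - rewrite -ltnS -(ltr_nat R) -natr1 natrM (lt_le_trans k1_lt) // lerD2r.
    by rewrite ler_wpM2l //; nra.
  - rewrite -ltnS -(ltr_nat R) -natr1 natrM (lt_le_trans k2_lt) // lerD2r.
    by rewrite ler_wpM2l //; nra.
  have N_gt0 : (0 < N)%N.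
    rewrite lt0n; apply: contraTneq N_large => ->.
    by rewrite mul0r -ltNge ltr_pwDr.
  (* With [minn C n] in place of [C] the sum bound persists, because each rate is at most [m]. *)
  pose s : R := 2 * m%:R - n%:R + (minn C n)%:R.
  have p12_s : p.1 + p.2 <= s.
    by rewrite /s /minn; case: ifP => _; rewrite ?subrK; lra.
  have s_ge1 : 1 <= s.
    have : (1 <= m + (m - n) + minn C n)%N by lia.
    by rewrite -(ler_nat R) !natrD natrB // /s; lra.
  have c_n : (minn C n)%:R <= n%:R :> R by rewrite ler_nat geq_minr.
  have : N%:R * ((1 - d) * (p.1 + p.2)) <= N%:R * s - N%:R * d.
    rewrite -mulrBr ler_wpM2l //.
    apply: (le_trans (ler_wpM2l d1 p12_s)).
    by rewrite mulrBl mul1r lerB // ler_peMr // ltW.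
  rewrite mulrDr mulrDr => Ns.
  rewrite -(ler_nat R) !natrD !natrM -subn1 natrB // mulrBl.
  by move: Ns; rewrite /s mulrDr mulrBr; lra.
exists (fun N => projT1 (cid (H N))); split; last first.
  by move=> N; case: (cid _) => /= c [].
apply: cvg_near_cst; near=> N.
case: (cid _) => /= c [_]; apply.
rewrite -ler_pdivrMr //; near: N.
exact: nbhs_infty_ger.
Unshelve. all: by end_near. Qed.

(** * Closedness of the region and approximation by scaling *)

Theorem theorem1 (R : realType) (m n C : nat) :
  (1 <= m)%N -> (n <= m)%N ->
  secrecy_capacity_region R m n C =
  [set p : R * R | 0 <= p.1 /\ 0 <= p.2 /\ p.1 <= m%:R /\ p.2 <= m%:R /\
                   p.1 + p.2 <= 2 * m%:R - n%:R + C%:R].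
Proof.
move=> m_gt0 nm; rewrite /secrecy_capacity_region; set P := [set p | _].
have cont1 : continuous (fst : R * R -> R) by move=> x; exact: cvg_fst.
have cont2 : continuous (snd : R * R -> R) by move=> x; exact: cvg_snd.
have cont12 : continuous (fun p : R * R => p.1 + p.2).
  by move=> x; apply: cvgD; [exact: cont1|exact: cont2].
have closedP : closed P.
  have cl (f : R * R -> R) A : continuous f -> closed A -> closed (f @^-1` A).
    by move=> f_cont; apply: preimage_closed => x _; exact: f_cont.
  have -> : P =
      (fst @^-1` [set x | 0 <= x]) `&` ((snd @^-1` [set x | 0 <= x]) `&`
      ((fst @^-1` [set x | x <= m%:R]) `&` ((snd @^-1` [set x | x <= m%:R]) `&`
      ((fun p : R * R => p.1 + p.2) @^-1`
         [set x | x <= 2 * m%:R - n%:R + C%:R])))).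
    by [].
  by do !apply: closedI; apply: cl => //; (exact: closed_ge || exact: closed_le).
apply/seteqP; split.
  rewrite [X in _ `<=` X](proj1 (closure_id P) closedP).
  by apply: closure_subset => p /(achievable_bounds _ _ _ _ _ nm).
move=> p [p1_ge0 [p2_ge0 [p1_le [p2_le p12_le]]]] V /= Vp.
(* The scaling factors are [1 - 1 / (k + 2)]: the index [k.+1] avoids [harmonic 0 = 1], since the
   defect must stay below 1. *)
have lim (x : R) : (1 - harmonic k.+1) * x @[k --> \oo] --> x.
  rewrite -[X in _ --> X]mul1r; apply: cvgMl.
  rewrite -[X in _ --> X]subr0; apply: cvgB; first exact: cvg_cst.
  by rewrite (cvg_shiftS (@harmonic R)); exact: cvg_harmonic.
have : \forall k \near \oo,
    V ((1 - harmonic k.+1) * p.1, (1 - harmonic k.+1) * p.2).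
  apply: (cvg_pair (lim p.1) (lim p.2)).
  by case: p Vp {p1_ge0 p2_ge0 p1_le p2_le p12_le}.
case=> k _ /(_ k (leqnn k)) Vk.
exists ((1 - harmonic k.+1) * p.1, (1 - harmonic k.+1) * p.2); split=> //.
apply: scaled_achievable => //.
rewrite /harmonic invr_gt0 ltr0n /= invf_lt1 ?ltr0n // ltr1n //.
Qed.
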